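(* Let $P$ be a program calling a library whose code is missing, where library functions may contain allocations, no field is accessed by both the program and the library, and there are no callbacks. Let $\tilde{\Pi}^*$ be the set of static points-to edges computed with $\Pi_{\text{miss}}=\tilde{\Pi}^*_{\text{miss}}$, the set of all missing points-to edges when using ideal proxy objects. Let $\Pi\subseteq\mathcal{V}_P\times(\mathcal{O}_P\cup\mathcal{O}_L)$ be the points-to set computed using the static analysis with all code available (and $\Pi_{\text{miss}}=\emptyset$). Then for all $x\in\mathcal{V}_P$: 1. for $o\in\mathcal{O}_P$, if $x\hookrightarrow o\in\tilde{\Pi}^*$, then $x\hookrightarrow o\in\Pi$; 2. for $\tilde{p}=\tilde{\phi}(\bar{o})\in\tilde{\mathcal{P}}$, where $\bar o$ is a concrete object allocated in library code during some execution, if $x\hookrightarrow\tilde{p}\in\tilde{\Pi}^*$, then $x\hookrightarrow o\in\Pi$, where $o$ is the statement where $\bar{o}$ was allocated.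
   Context: Programs. The available program $P$ is a finite set of statements over a finite set $\mathcal{V}_P$ of program (visible) variables: allocations $x\gets X()$ ($X$ a class), assignments $x\gets y$, loads $x\gets y.f$, stores $x.f\gets y$ ($f$ a field), and library calls $x\gets m(y)$, where $m\in\mathcal{M}$ is a library function (each has exactly one parameter $p_m$ and a return value $r_m$). $P$ contains no functions of its own. Control flow is not modelled: an execution runs some finite sequence of statements of $P$, starting with all variables null. Library functions are implemented by statements of the same kinds (allocations allowed) over their own variables (disjoint from $\mathcal{V}_P$). A call $x\gets m(y)$ assigns $y$ to $p_m$, runs the body of $m$, and then assigns $r_m$ to $x$. Disjoint fields: no field is accessed both by a load or store of $P$ and by a load or store of the library. No callbacks from the library into $P$. Objects. Abstract objects are allocation statements: $\mathcal{O}_P$ those in $P$ and $\mathcal{O}_L$ those in the library. Each execution of an allocation statement $o$ creates a fresh concrete object, said to be allocated at $o$. We write $x\hookrightarrow\bar o$ during an execution if $x$ points to the concrete object $\bar o$ at some point of it. The dynamic footprint of a concrete object $\bar o$ is $\{x\in\mathcal{V}_P\mid x\hookrightarrow\bar o\text{ during the execution}\}$. An ideal proxy object is an element of $\tilde{\mathcal{P}}=2^{\mathcal{V}_P}$, and the ideal proxy object mapping $\tilde\phi$ sends each concrete object $\bar o$ allocated in library code to its dynamic footprint $\tilde\phi(\bar o)\in\tilde{\mathcal{P}}$. Static analysis. Given a set of statements and a set $\Pi_{\text{miss}}$ of edges, the computed set $\Pi$ is the least set of edges such that: (1) for every allocation $o=(x\gets X())$, $x\hookrightarrow o\in\Pi$;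 (2) if $x\gets y$ is a statement and $y\hookrightarrow a\in\Pi$ then $x\hookrightarrow a\in\Pi$; (3) if $x\gets y.f$ and $z.f\gets w$ are statements and $y\hookrightarrow a',z\hookrightarrow a',w\hookrightarrow a\in\Pi$ then $x\hookrightarrow a\in\Pi$; (4) $\Pi_{\text{miss}}\subseteq\Pi$. When library code is missing, the analysis is applied to the statements of $P$ only, with library calls treated as no-ops and $\Pi_{\text{miss}}\subseteq\mathcal{V}_P\times(\mathcal{O}_P\cup\tilde{\mathcal{P}})$. With all code available, it is applied to the statements of $P$ and of the library together, each call $x\gets m(y)$ (in $P$ or in the library) being replaced by the assignments $p_m\gets y$ and $x\gets r_m$, and the result is restricted to variables in $\mathcal{V}_P$. Missing edges. $\tilde{\Pi}^*_{\text{miss}}$ is the set of all edges $x\hookrightarrow a$, $x\in\mathcal{V}_P$, such that in some execution $x\hookrightarrow\bar o$ for a concrete object $\bar o$ with either $\bar o$ allocated at $a\in\mathcal{O}_P$, or $\bar o$ allocated in library code and $a=\tilde\phi(\bar o)$, and such that $x\hookrightarrow a$ is not in the set computed by the analysis with missing library code and $\Pi_{\text{miss}}=\emptyset$. *)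

(* Defs.v *)
From HB Require Import structures.
From mathcomp Require Import all_boot finmap.

Set Implicit Arguments.
Unset Strict Implicit.
Unset Printing Implicit Defensive.

Local Open Scope fset_scope.

(* Statements over the variables W, with classes C, fields F and library
   functions M. *)

Variant prim (W C F : Type) : Type :=
| Alloc (x : W) (X : C)             (* x <- X() *)
| Assign (x y : W)                  (* x <- y *)
| FieldLoad (x y : W) (f : F)            (* x <- y.f *)
| FieldStore (x : W) (f : F) (y : W).    (* x.f <- y *)

Variant stmt (W C F M : Type) : Type :=
| Prim (s : prim W C F)
| Call (x : W) (m : M) (y : W).     (* x <- m(y) *)

Arguments Alloc {W C F} x X.
Arguments Assign {W C F} x y.
Arguments FieldLoad {W C F} x y f.
Arguments FieldStore {W C F} x f y.
Arguments Prim {W C F M} s.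
Arguments Call {W C F M} x m y.

Section StmtChoice.
Variables W C F M : choiceType.

Definition prim_code (s : prim W C F) :
    (W * C) + (W * W) + (W * W * F) + (W * F * W) :=
  match s with
  | Alloc x X => inl (inl (inl (x, X)))
  | Assign x y => inl (inl (inr (x, y)))
  | FieldLoad x y f => inl (inr (x, y, f))
  | FieldStore x f y => inr (x, f, y)
  end.

Definition prim_decode (c : (W * C) + (W * W) + (W * W * F) + (W * F * W)) :
    prim W C F :=
  match c with
  | inl (inl (inl (x, X))) => Alloc x X
  | inl (inl (inr (x, y))) => Assign x y
  | inl (inr (x, y, f)) => FieldLoad x y f
  | inr (x, f, y) => FieldStore x f y
  end.

Lemma prim_codeK : cancel prim_code prim_decode.
Proof. by case. Qed.

HB.instance Definition _ := Choice.copy (prim W C F) (can_type prim_codeK).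

Definition stmt_code (s : stmt W C F M) : prim W C F + (W * M * W) :=
  match s with Prim p => inl p | Call x m y => inr (x, m, y) end.

Definition stmt_decode (c : prim W C F + (W * M * W)) : stmt W C F M :=
  match c with inl p => Prim p | inr (x, m, y) => Call x m y end.

Lemma stmt_codeK : cancel stmt_code stmt_decode.
Proof. by case. Qed.

HB.instance Definition _ := Choice.copy (stmt W C F M) (can_type stmt_codeK).
End StmtChoice.

Section Rename.
Variables (W W' C F M : Type) (i : W -> W').

Definition map_prim (s : prim W C F) : prim W' C F :=
  match s with
  | Alloc x X => Alloc (i x) X
  | Assign x y => Assign (i x) (i y)
  | FieldLoad x y f => FieldLoad (i x) (i y) f
  | FieldStore x f y => FieldStore (i x) f (i y)
  end.

Definition map_stmt (s : stmt W C F M) : stmt W' C F M :=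
  match s with
  | Prim p => Prim (map_prim p)
  | Call x m y => Call (i x) m (i y)
  end.
End Rename.

Definition accesses (W C M : Type) (F : eqType) (f : F) (s : stmt W C F M) :
    bool :=
  match s with
  | Prim (FieldLoad _ _ g) | Prim (FieldStore _ g _) => g == f
  | _ => false
  end.

(* Library code ranges over its own type L of variables, so it shares no
   variable with a program; its only calls are to library functions, so there
   are no callbacks. *)
Record library (L C F M : choiceType) := Library {
  param : M -> L;
  ret : M -> L;
  body : M -> {fset stmt L C F M}
}.

Section PointsTo.
Variables (V : finType) (L C F M : choiceType).
Variables (P : {fset stmt V C F M}) (lib : library L C F M).

Definition disjoint_fields : Prop :=
  forall (f : F) (s : stmt V C F M) (m : M) (t : stmt L C F M),
    s \in P -> accesses f s -> t \in body lib m -> ~~ accesses f t.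

Definition var : choiceType := (V + L)%type.

(* The allocation statement x <- X() is identified with the pair (x, X): it is
   a program allocation if x is [inl _], a library allocation if x is [inr _]. *)
Definition site : choiceType := (var * C)%type.

(* [expands ss t]: t is a sequence of primitive statements performed by running
   the statements ss in order.  As control flow is not modelled, running the
   body of a library function runs some finite sequence of its statements. *)
Inductive expands : seq (stmt var C F M) -> seq (prim var C F) -> Prop :=
| expands_nil : expands [::] [::]
| expands_prim s ss t :
    expands ss t -> expands (Prim s :: ss) (s :: t)
| expands_call x m y (bs : seq (stmt L C F M)) tb ss t :
    {subset bs <= body lib m} ->
    expands (map (map_stmt inr) bs) tb ->
    expands ss t ->
    expands (Call x m y :: ss)
      (Assign (inr (param lib m)) y :: tb ++ Assign x (inr (ret lib m)) :: t).

Definition execution (t : seq (prim var C F)) : Prop :=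
  exists ps : seq (stmt V C F M),
    {subset ps <= P} /\ expands (map (map_stmt inl) ps) t.

(* Concrete objects are numbered in the order of their creation: object n was
   allocated at the n-th entry of [sites].  [None] is the null reference. *)
Record state := State {
  env : var -> option nat;
  heap : nat * F -> option nat;
  sites : seq site
}.

Definition init : state := State (fun=> None) (fun=> None) [::].

(* Dereferencing null has no effect. *)
Definition step (st : state) (s : prim var C F) : state :=
  match s with
  | Alloc x X =>
      State [eta env st with x |-> Some (size (sites st))] (heap st)
        (rcons (sites st) (x, X))
  | Assign x y => State [eta env st with x |-> env st y] (heap st) (sites st)
  | FieldLoad x y f =>
      if env st y is Some o
      then State [eta env st with x |-> heap st (o, f)] (heap st) (sites st)
      else st
  | FieldStore x f y =>
      if env st x is Some o
      then State (env st) [eta heap st with (o, f) |-> env st y] (sites st)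
      else st
  end.

Definition points_to (t : seq (prim var C F)) (x : var) (o : nat) : bool :=
  has (fun st => env st x == Some o) (init :: scanl step init t).

Definition allocated_at (t : seq (prim var C F)) (o : nat) (a : site) : Prop :=
  onth (sites (foldl step init t)) o = Some a.

(* The dynamic footprint; on objects allocated in library code it is the ideal
   proxy object mapping. *)
Definition footprint (t : seq (prim var C F)) (o : nat) : {set V} :=
  [set x | points_to t (inl x) o].

(* [analysis S mk miss]: the points-to edges computed from the statements S and
   the edges miss, where [mk x X] is the abstract object of x <- X(). *)
Inductive analysis (W A : Type) (S : prim W C F -> Prop) (mk : W -> C -> A)
    (miss : W -> A -> Prop) : W -> A -> Prop :=
| analysis_alloc x X : S (Alloc x X) -> analysis S mk miss x (mk x X)
| analysis_assign x y a :
    S (Assign x y) -> analysis S mk miss y a -> analysis S mk miss x a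
| analysis_heap x y f z w a' a :
    S (FieldLoad x y f) -> S (FieldStore z f w) ->
    analysis S mk miss y a' -> analysis S mk miss z a' ->
    analysis S mk miss w a -> analysis S mk miss x a
| analysis_miss x a : miss x a -> analysis S mk miss x a.

Definition no_edge (W A : Type) (x : W) (a : A) : Prop := False.

Variant aobj :=
| Site (v : V) (X : C)
| Proxy (p : {set V}).

Definition analysis_missing (miss : V -> aobj -> Prop) : V -> aobj -> Prop :=
  analysis (fun s => Prim s \in P) Site miss.

Definition inline (s : stmt var C F M) : seq (prim var C F) :=
  match s with
  | Prim p => [:: p]
  | Call x m y =>
      [:: Assign (inr (param lib m)) y; Assign x (inr (ret lib m))]
  end.

Definition all_code (s : prim var C F) : Prop :=
  (exists2 u, u \in P & s \in inline (map_stmt inl u)) \/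
  (exists m, exists2 u, u \in body lib m & s \in inline (map_stmt inr u)).

Definition analysis_full (x : V) (a : site) : Prop :=
  analysis all_code (fun y X => (y, X) : site) (@no_edge _ _) (inl x) a.

Definition abstracts (t : seq (prim var C F)) (o : nat) (a : aobj) : Prop :=
  match a with
  | Site v X => allocated_at t o (inl v, X)
  | Proxy p => (exists l X, allocated_at t o (inr l, X)) /\ p = footprint t o
  end.

Definition ideal_miss (x : V) (a : aobj) : Prop :=
  (exists t o, [/\ execution t, points_to t (inl x) o & abstracts t o a]) /\
  ~ analysis_missing (@no_edge _ _) x a.

Definition ideal_analysis : V -> aobj -> Prop := analysis_missing ideal_miss.

End PointsTo.

Arguments Site {V C} v X.
Arguments Proxy {V C} p.

(* Main.v *)
Require Import Defs.
From mathcomp Require Import all_boot finmap.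

(** The analysis with all code available is sound: if a variable ever points to
    a concrete object, the analysis gives it the allocation site of that object.
    The theorem follows by induction on the derivation of an edge of the ideal
    analysis.  A missing edge [x -> p] to a proxy comes from an object with
    footprint [p], so [x] belongs to [p], hence [x] points to every object, of
    any execution, whose footprint is [p], and soundness applies to each of
    them.  In the load/store rule through a proxy [p], the induction hypotheses
    are joined at the allocation site of some object with footprint [p]. *)

Set Implicit Arguments.
Unset Strict Implicit.
Unset Printing Implicit Defensive.

Section Soundness.
Variables (V : finType) (L C F : choiceType).
Variable S : prim (var V L) C F -> Prop.

Let pt : var V L -> site V L C -> Prop :=
  analysis S (fun y X => (y, X)) (@no_edge _ _).

Definition sound_env (st : state V L C F) : Prop :=
  forall x o, env st x = Some o -> exists2 a, onth (sites st) o = Some a & pt x a.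

(** A filled field is traced to a store that may have written it; the data kept are the premises of
    the load/store rule that a later load does not supply. *)
Definition sound_heap (st : state V L C F) : Prop :=
  forall o f o', heap st (o, f) = Some o' ->
  exists z w a a', [/\ S (FieldStore z f w), onth (sites st) o = Some a, pt z a,
    onth (sites st) o' = Some a' & pt w a'].

Lemma onth_sites_step (st : state V L C F) s o a :
  onth (sites st) o = Some a -> onth (sites (step st s)) o = Some a.
Proof.
case: s => [x X|x y|x y f|x f y] //=; try by case: (env _ _).
rewrite !onthE map_rcons nth_rcons size_map.
(* Beyond the old sites the premise would read [None = Some a]. *)
by case: ltnP => // le_st; rewrite nth_default ?size_map.
Qed.

Lemma onth_sites_run (st : state V L C F) t o a :
  onth (sites st) o = Some a -> onth (sites (foldl (@step V L C F) st t)) o = Some a.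
Proof. by elim: t st => //= s t IHt st /(onth_sites_step s)/IHt. Qed.

Lemma sound_env_step st s :
  S s -> sound_env st -> sound_heap st -> sound_env (step st s).
Proof.
move=> Ss envP heapP x o.
case: s Ss => [z X|z y|z y f|z f y] Ss /=.
- case: eqP => [-> [<-]|_ /envP[a sa xa]].
    exists (z, X); last exact: analysis_alloc.
    by rewrite onthE map_rcons nth_rcons size_map ltnn eqxx.
  by exists a => //; exact: (@onth_sites_step st (Alloc z X)).
- case: eqP => [-> /envP[a sa ya]|_ /envP//].
  by exists a => //; exact: analysis_assign ya.
- case yo: (env st y) => [o'|] /=; last exact: envP.
  case: eqP => [-> /heapP|_ /envP//].
  move=> [u [w [a' [a [Su sa' ua' sa wa]]]]].
  have [b sb yb] := envP _ _ yo.
  (* The dereferenced object has a single site, so [y] and the base [u] of the store share the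
     abstract object [a']. *)
  move: sb; rewrite sa' => -[eq_a'b]; rewrite -eq_a'b in yb.
  by exists a => //; exact: analysis_heap Ss Su yb ua' wa.
- by case: (env st z) => [?|]; exact: envP.
Qed.

Lemma sound_heap_step st s :
  S s -> sound_env st -> sound_heap st -> sound_heap (step st s).
Proof.
move=> Ss envP heapP o f o'.
have old : heap st (o, f) = Some o' ->
    exists z w a a', [/\ S (FieldStore z f w),
      onth (sites (step st s)) o = Some a, pt z a,
      onth (sites (step st s)) o' = Some a' & pt w a'].
  move=> /heapP[z [w [a [a' [Sz sa za sa' wa']]]]].
  by exists z, w, a, a'; split=> //; exact: onth_sites_step.
case: s Ss old => [z X|z y|z y g|z g y] Ss //=; first by case: (env st y).
case zo: (env st z) => [o1|] //= old.
case: eqP => [[-> eq_fg]|_ /old//] /envP[a' sa' ya'].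
have [a sa za] := envP _ _ zo.
by exists z, y, a, a'; split; rewrite ?eq_fg.
Qed.

Lemma analysis_sound t x o a :
  (forall s, s \in t -> S s) -> points_to t x o -> allocated_at t o a -> pt x a.
Proof.
rewrite /points_to /allocated_at => St.
have : sound_env (init V L C F) by [].
have : sound_heap (init V L C F) by [].
elim: t (init V L C F) St => [|s t IHt] st St heapP envP.
  by rewrite /= orbF => /eqP/envP[b -> xb] [<-].
(* The edge is found in the current state, whereas [allocated_at] reads the final one; sites persist
   in between. *)
case/orP => [/eqP/envP[b /(onth_sites_run (s :: t)) -> xb] [<-] //|].
have Ss : S s by apply: St; rewrite mem_head.
apply: IHt => [u ut||].
- by apply: St; rewrite inE ut orbT.
- exact: sound_heap_step.
- exact: sound_env_step.
Qed.

End Soundness.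

Section Executions.
Variables (V : finType) (L C F M : choiceType).
Variables (P : {fset stmt V C F M}) (lib : library L C F M).

(** The hypothesis speaks of [inline] rather than of membership in [P], so that the induction also
    applies to library bodies and nested calls. *)
Lemma expands_all_code ss t :
  expands lib ss t ->
  (forall u s, u \in ss -> s \in inline lib u -> all_code P lib s) ->
  forall s, s \in t -> all_code P lib s.
Proof.
elim=> {ss t} [|s ss t _ IHt|x m y bs tb ss t bsP _ IHb _ IHt] codeP //.
- move=> u /[!inE] /orP[/eqP->|].
    by apply: (codeP (Prim s)); rewrite inE eqxx.
  by apply: IHt => u' v ssu'; apply: codeP; rewrite inE ssu' orbT.
- have callP : forall s, s \in inline lib (Call x m y) -> all_code P lib s.
    by move=> s; apply: codeP; rewrite mem_head.
  move=> s; rewrite inE mem_cat inE => /or4P[/eqP->| |/eqP->|].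
  + by apply: callP; rewrite !inE eqxx.
  + apply: IHb => _ v /mapP[b /bsP mb ->] vb.
    by right; exists m, b.
  + by apply: callP; rewrite !inE eqxx orbT.
  + by apply: IHt => u v ssu; apply: codeP; rewrite inE ssu orbT.
Qed.

Lemma analysis_full_sound t x o a :
  execution P lib t -> points_to t (inl x) o -> allocated_at t o a ->
  analysis_full P lib x a.
Proof.
move=> [ps [psP ext]]; apply: analysis_sound; apply: expands_all_code ext _.
by move=> _ s /mapP[u /psP Pu ->] us; left; exists u.
Qed.

Lemma all_code_prim (s : prim V C F) :
  Prim s \in P -> all_code P lib (map_prim inl s).
Proof. by move=> Ps; left; exists (Prim s); rewrite //= mem_head. Qed.

(** A relation, not a function: objects from different sites and executions may share a footprint,
    so one proxy may stand for several sites. *)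
Definition concretizes (a : aobj V C) (b : site V L C) : Prop :=
  match a with
  | Site v X => b = (inl v, X)
  | Proxy p => exists t o l X, [/\ execution P lib t,
      allocated_at t o (inr l, X), p = footprint t o & b = (inr l, X)]
  end.

(** Proxies enter only through missing edges, each of which comes with an execution and an
    object. *)
Lemma ideal_analysis_concretizes x a :
  ideal_analysis P lib x a -> exists b, concretizes a b.
Proof.
elim=> {x a} [x X _|x y a _ _ //|x y f z w a' a _ _ _ _ _ _ _ //|x a].
  by exists (inl x, X).
case: a => [v X _|p [[t [o [ext _ [[l [X alX]] pE]]]] _]]; first by exists (inl v, X).
by exists (inr l, X), t, o, l, X.
Qed.

Lemma ideal_analysis_full x a b :
  ideal_analysis P lib x a -> concretizes a b -> analysis_full P lib x b.
Proof.
(* The site [b] stays general so that the load/store case can use one site [b'] for both [y] and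
   [z]. *)
move=> xa; elim: xa b => {x a}.
- by move=> x X /all_code_prim Ps _ ->; exact: analysis_alloc.
- move=> x y a /all_code_prim Ps _ IHy b /IHy.
  exact: analysis_assign.
- move=> x y f z w a' a /all_code_prim Px /all_code_prim Pz ya' IHy _ IHz _ IHw b ab.
  have [b' ab'] := ideal_analysis_concretizes ya'.
  exact: analysis_heap Px Pz (IHy _ ab') (IHz _ ab') (IHw _ ab).
- move=> x [v X|p] [[t [o [ext xo ao]]] _] b.
    by move=> ->; exact: analysis_full_sound xo ao.
  move: ao => [_ pE] [t' [o' [l' [X' [ext' alX' pE' ->]]]]].
  have xp : x \in p by rewrite pE inE.
  apply: (analysis_full_sound ext' _ alX').
  by move: xp; rewrite pE' inE.
Qed.

End Executions.

Theorem proposition5 (V : finType) (L C F M : choiceType)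
    (P : {fset stmt V C F M}) (lib : library L C F M)
    (hdisj : disjoint_fields P lib) (x : V) :
  (forall (v : V) (X : C),
      Prim (Alloc v X) \in P ->
      ideal_analysis P lib x (Site v X) ->
      analysis_full P lib x (inl v, X))
  /\
  (forall (p : {set V}) (t : seq (prim (var V L) C F)) (o : nat)
      (l : L) (X : C),
      execution P lib t ->
      allocated_at t o (inr l, X) ->
      p = footprint t o ->
      ideal_analysis P lib x (Proxy p) ->
      analysis_full P lib x (inr l, X)).
Proof.
split=> [v X _ xv|p t o l X ext alX pE xp].
  exact: ideal_analysis_full xv _.
by apply: ideal_analysis_full xp _; exists t, o, l, X.
Qed.
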